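(* Let $N\in\{1,2,\dots\}$ and let $\mu\in(0,\pi)\setminus\left\{\frac{j\pi}{N+1}: j=1,\dots,N\right\}$. Then the polynomial \[ S_{N}(z,\mu)= \sum_{k=1}^N \frac{N+1-k}{N}\, \frac{\sin(k\mu)}{\sin\mu}\, z^k \] is not typically real in the open unit disc $\mathbb D$, and hence is not univalent in $\mathbb D$.
   Context: Here $\mathbb D=\{z\in\mathbb C:|z|<1\}$, and univalent in $\mathbb D$ means injective in $\mathbb D$. A polynomial $f$ with real coefficients is called typically real in $\mathbb D$ if $\operatorname{Im} f(z)\ge 0$ for all $z\in\mathbb D$ with $\operatorname{Im} z>0$; equivalently, $\operatorname{Im} f(e^{it})\ge 0$ for all $t\in[0,\pi]$. For the excluded values $\mu=\frac{j\pi}{N+1}$, $j=1,\dots,N$, the polynomials $S_N(z,\mu)$ are the Suffridge polynomials, which are univalent in $\mathbb D$.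
   Formalization: The cases N = 1 (where S_1(z,μ) = z) and N = 2 with π/3 < μ < 2π/3 (where S_2(z,μ) = z + cos(μ) z² with |cos μ| < 1/2) are excluded, because there the polynomial is typically real and univalent and the claim fails. *)

(* Defs.v *)
From HB Require Import structures.
From mathcomp Require Import all_boot all_order all_algebra.
From mathcomp Require Import all_classical all_reals all_analysis.
From mathcomp Require Import complex.
Set Implicit Arguments.
Unset Strict Implicit.
Unset Printing Implicit Defensive.
Import Order.TTheory GRing.Theory Num.Theory.
Local Open Scope classical_set_scope.
Local Open Scope ring_scope.

(* The norm and the order are those of R[i]: `|z| < 1 compares two elements
   of R[i] with zero imaginary part. *)
Definition unit_disc (R : realType) : set R[i] := [set z | `|z| < 1].

Definition ceval (R : realType) (f : {poly R}) (z : R[i]) : R[i] :=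
  (map_poly (real_complex R) f).[z].

Definition typically_real (R : realType) (f : {poly R}) : Prop :=
  forall z : R[i], unit_disc z -> 0 < complex.Im z -> 0 <= complex.Im (ceval f z).

Definition univalent (R : realType) (f : R[i] -> R[i]) : Prop :=
  set_inj (@unit_disc R) f.

Definition suffridge (R : realType) (N : nat) (mu : R) : {poly R} :=
  \sum_(1 <= k < N.+1)
    ((N.+1 - k)%:R / N%:R * (sin (k%:R * mu) / sin mu)) *: 'X^k.

(* Main.v *)
Require Import Defs.
From mathcomp Require Import all_boot all_order all_algebra.
From mathcomp Require Import all_classical all_reals all_analysis.
From mathcomp Require Import complex.
From mathcomp Require Import ring lra.
Import Order.TTheory GRing.Theory Num.Theory.
Local Open Scope ring_scope.

(** On the unit circle, $N\sin\mu\cdot\operatorname{Im} S_N(e^{it},\mu)=\sum_k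
    (N+1-k)\sin(k\mu)\sin(kt)$. By product-to-sum, four times this sum is $K(t-\mu)-K(t+\mu)$, where
    $K(x)=N+1+2\sum_k (N+1-k)\cos(kx)$ is a Fejer kernel, nonnegative and with explicit zeros
    ([fejer_sum]). Choose $t=\mu+s\in(0,\pi)$ with $s=\pm 2\pi/(N+1)$ ([suffridge_angle]): then
    $K(s)=0$, while $K(2\mu+s)>0$ because $(N+1)\mu$ is not a multiple of $\pi$. Hence the imaginary
    part is negative at $e^{it}$ ([fejer_sin_sum_lt0]). Near 0 on the same ray it is positive, since
    the coefficient of $z$ is 1. It therefore changes sign inside the disc, which refutes both
    properties ([Im_lt0_not_typically_real_univalent]). *)

Lemma sin_neq0_nat_pi {R : realType} {x : R} :
  0 <= x -> (forall j : nat, x <> j%:R * pi) -> sin x != 0.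
Proof.
move=> x_ge0 x_npi; have pi0 := pi_gt0 R.
have /andP[] := truncn_itv (divr_ge0 x_ge0 (ltW pi0)).
set j := Num.trunc _; rewrite ler_pdivlMr// ltr_pdivrMr// -natr1 => jx xj.
have y_itv : 0 < x - j%:R * pi < pi.
  have xj' : j%:R * pi != x by rewrite eq_sym; apply/eqP/x_npi.
  by move: (lt_neqAle (j%:R * pi) x); rewrite xj' jx /=; lra.
have -> : x = (x - j%:R * pi) + pi *+ j by rewrite -mulr_natl; ring.
rewrite (alternatingn (@sinDpi R)) mulf_neq0 ?signr_eq0//.
by rewrite gt_eqF// sin_gt0_pi.
Qed.

Lemma cos_double_lt1 {R : realType} {x : R} : sin x != 0 -> cos (x + x) < 1.
Proof.
move=> sx; rewrite cosD -!expr2; have := cos2Dsin2 x.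
by have : 0 < sin x ^+ 2; [rewrite exprn_even_gt0 | lra].
Qed.

Lemma cos_lt1 {R : realType} {x : R} : 0 < x < pi *+ 2 -> cos x < 1.
Proof.
move=> x_itv; have -> : x = x / 2 + x / 2 by lra.
by apply: cos_double_lt1; rewrite gt_eqF// sin_gt0_pi//; lra.
Qed.

Lemma dirichlet_sum (R : realType) (N : nat) (x : R) :
  (\sum_(1 <= k < N.+1) cos (k%:R * x)) * (2 * (1 - cos x)) =
  cos (N%:R * x) - cos (N.+1%:R * x) - (1 - cos x).
Proof.
elim: N => [|N IHN]; first by rewrite big_geq// !mul0r mul1r cos0; ring.
rewrite big_nat_recr//= mulrDl IHN.
have -> : N.+2%:R * x = N.+1%:R * x + x by rewrite -(natr1 N.+1); ring.
have -> : N%:R * x = N.+1%:R * x - x by rewrite -natr1; ring.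
by rewrite cosB cosD; ring.
Qed.

(** The closed form of the Fejer kernel, multiplied by $2(1-\cos x)=4\sin^2(x/2)$ to avoid a
    division. Raising $N$ by one raises every weight by one, so the increment is a Dirichlet sum. *)
Lemma fejer_sum (R : realType) (N : nat) (x : R) :
  (\sum_(1 <= k < N.+1) (N.+1 - k)%:R * cos (k%:R * x)) * (2 * (1 - cos x)) =
  1 - cos (N.+1%:R * x) - N.+1%:R * (1 - cos x).
Proof.
elim: N => [|N IHN]; first by rewrite big_geq// !mul0r mul1r; ring.
have -> : \sum_(1 <= k < N.+2) (N.+2 - k)%:R * cos (k%:R * x) =
    \sum_(1 <= k < N.+1) (N.+1 - k)%:R * cos (k%:R * x) +
    \sum_(1 <= k < N.+2) cos (k%:R * x).
  rewrite !(big_nat_recr N.+1)//= addrA -big_split/= subSnn mul1r.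
  congr (_ + _); apply: eq_big_nat => k /andP[_ kN].
  by rewrite (subSn (ltnW kN)) -natr1; ring.
by rewrite mulrDl IHN dirichlet_sum -(natr1 N.+1); ring.
Qed.

(* With the Fejer kernel K x = sin^2 ((N+1) x / 2) / sin^2 (x / 2), four times
   the sum is K s - K (2 mu + s), where K s = 0 < K (2 mu + s). *)
Lemma fejer_sin_sum_lt0 (R : realType) (N : nat) (mu s : R) :
  cos (N.+1%:R * s) = 1 -> cos s < 1 -> cos (mu + (mu + s)) < 1 ->
  cos (N.+1%:R * (mu + (mu + s))) < 1 ->
  \sum_(1 <= k < N.+1) (N.+1 - k)%:R * (sin (k%:R * mu) * sin (k%:R * (mu + s)))
    < 0.
Proof.
move=> cNs cs cms cNms; set S := (X in X < 0).
pose F x : R := \sum_(1 <= k < N.+1) (N.+1 - k)%:R * cos (k%:R * x).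
have S_eq : 2 * S = F s - F (mu + (mu + s)).
  rewrite mulr_sumr -sumrB; apply: eq_bigr => k _.
  have -> : k%:R * s = k%:R * (mu + s) - k%:R * mu by ring.
  by rewrite (mulrDr _ mu (mu + s)) cosB (cosD (k%:R * mu)); ring.
(* This says $K(s)=0$; the strict bound [Fms] below says $K(2\mu+s)>0$. *)
have Fs : 2 * F s = - N.+1%:R.
  have s0 : 1 - cos s != 0 by lra.
  by apply: (mulIf s0); have := fejer_sum R N s; rewrite cNs -/(F s); lra.
have Fms : - N.+1%:R < 2 * F (mu + (mu + s)).
  have s0 : 0 < 1 - cos (mu + (mu + s)) by lra.
  rewrite -(ltr_pM2r s0).
  by have := fejer_sum R N (mu + (mu + s)); rewrite -/(F _); lra.
lra.
Qed.

(** With $d=2\pi/(N+1)$, $s=-d$ works if $\mu>d$ and $s=d$ works if $\mu<\pi-d$. Both fail only if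
    $\pi-d\le\mu\le d$, which forces $d\ge\pi/2$, so $N\le 3$. For $N=3$ this leaves $\mu=\pi/2$, an
    excluded value. For $N=2$ it leaves $[\pi/3,2\pi/3]$, whose endpoints are excluded values and
    whose interior is ruled out by the last hypothesis. *)
Lemma suffridge_angle (R : realType) (N : nat) (mu : R) :
  0 < mu < pi ->
  (forall j : nat, (1 <= j <= N)%N -> mu <> j%:R * pi / N.+1%:R) ->
  (1 < N)%N -> (N = 2%N -> ~ (pi / 3 < mu < 2 * pi / 3)) ->
  exists2 s : R, s = 2 * pi / N.+1%:R \/ s = - (2 * pi / N.+1%:R) &
    0 < mu + s < pi.
Proof.
move=> mu_itv hexcl N_gt1 hN2; have pi0 := pi_gt0 R.
set d := 2 * pi / N.+1%:R.
have dE : d * N.+1%:R = 2 * pi by rewrite divfK.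
have d_gt0 : 0 < d by rewrite divr_gt0// mulr_gt0.
have [d_lt|d_ge] := ltP d mu; first by exists (- d); [right | lra].
have [d_lt|d_ge'] := ltP mu (pi - d); first by exists d; [left | lra].
exfalso; case: (ltngtP N 2) N_gt1 => // [N_gt2|N2] _.
  have le4 : 4 <= N.+1%:R :> R by rewrite ler_nat.
  have d4 : d * 4 <= 2 * pi by rewrite -dE ler_pM2l.
  have dpi : d = pi / 2 by lra.
  have N3 : N.+1%:R = 4 :> R.
    by have d0 : d != 0; [lra | apply: (mulfI d0); lra].
  apply: (hexcl 2%N); first exact: ltnW.
  by rewrite N3; lra.
apply: hN2 => //; subst N.
have := hexcl 1%N isT; have := hexcl 2%N isT => /eqP h2 /eqP h1.
have {}h1 : mu != pi / 3 by rewrite mul1r in h1.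
by rewrite !lt_neqAle (eq_sym _ mu) h1 h2 /=; move: d_ge d_ge'; rewrite /d; lra.
Qed.

Definition polar {R : realType} (r t : R) : R[i] :=
  Complex (r * cos t) (r * sin t).

Lemma polarX (R : realType) (r t : R) (k : nat) :
  polar r t ^+ k = polar (r ^+ k) (k%:R * t).
Proof.
elim: k => [|k IHk]; first by rewrite /polar !expr0 mul0r cos0 sin0 mulr1 mulr0.
rewrite exprS IHk -natr1 mulrDl mul1r /polar cosD sinD exprS.
by apply/eqP; rewrite eq_complex/=; apply/andP; split; apply/eqP; ring.
Qed.

Lemma polar_unit_disc {R : realType} (r t : R) :
  0 <= r < 1 -> unit_disc (polar r t).
Proof.
move=> /andP[r0 r1]; rewrite /unit_disc /= normc_def /= !exprMn -mulrDr.
by rewrite cos2Dsin2 mulr1 sqrtr_sqr ger0_norm// ltcE /= eqxx.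
Qed.

Lemma Im_ceval_polar {R : realType} {f : {poly R}} (n : nat) (r t : R) :
  (size f <= n)%N ->
  complex.Im (ceval f (polar r t)) =
  \sum_(k < n) f`_k * (r ^+ k * sin (k%:R * t)).
Proof.
move=> f_n; rewrite /ceval (horner_coef_wide _ (n := n)) ?size_map_poly//.
rewrite (big_morph (@complex.Im R) (id1 := 0) (op1 := +%R)) //; last first.
  by move=> [a b] [c d].
apply: eq_bigr => k _; rewrite coef_map polarX /=.
by rewrite mul0r addr0.
Qed.

Lemma ceval_conj {R : realType} (f : {poly R}) (z : R[i]) :
  ceval f (conjc z) = conjc (ceval f z).
Proof.
rewrite /ceval -horner_map /= -map_poly_comp.
by congr (_.[_]); apply: eq_map_poly => x /=; rewrite oppr0.
Qed.

(* Im f(r e^{it}) = r h(r) for a real polynomial h with h(0) > 0 > h(1), so h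
   takes the values 0 and h(1) / 2 in (0, 1); at a zero of h, f identifies the
   two conjugate points r e^{it} and r e^{-it}. *)
Lemma Im_lt0_not_typically_real_univalent
    {R : realType} {f : {poly R}} {t : R} :
  0 < f`_1 -> 0 < t < pi -> complex.Im (ceval f (polar 1 t)) < 0 ->
  ~ typically_real f /\ ~ univalent (ceval f).
Proof.
move=> f1 /sin_gt0_pi st; pose h := \poly_(k < (size f).-1)
  (f`_k.+1 * sin (k.+1%:R * t)).
have ImE r : complex.Im (ceval f (polar r t)) = r * h.[r].
  rewrite (Im_ceval_polar _ _ _ (leqnn _)) horner_poly mulr_sumr.
  case: (size f) => [|m]; first by rewrite !big_ord0.
  rewrite big_ord_recl /= mul0r sin0 !mulr0 add0r; apply: eq_bigr => k _.
  by rewrite exprS; ring.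
rewrite ImE mul1r => h1.
have h0 : 0 < h.[0].
  rewrite horner_coef0 coef_poly mul1r; case: ifPn => [_|].
    exact: mulr_gt0.
  rewrite -leqNgt => sz; move: f1; rewrite nth_default ?ltxx//.
  by move: sz; case: (size f) => // -[].
have hval c : h.[1] < c < h.[0] -> exists2 r, 0 < r < 1 & h.[r] = c.
  move=> c_itv; have [|r] := @poly_ivt R (c%:P - h) 0 1 ler01.
    by rewrite !hornerE; lra.
  move=> r_itv; rewrite rootE !hornerE subr_eq0 => /eqP hr.
  exists r => //; have r0 : r != 0 by apply/eqP => r0; rewrite r0 in hr; lra.
  have r1 : r != 1 by apply/eqP => r1; rewrite r1 in hr; lra.
  by rewrite !lt_neqAle eq_sym r0 r1.
split.
  (* The point $e^{it}$ lies outside the open disc, so a negative value is needed at some $r<1$. *)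
  have [|r r_itv hr] := hval (h.[1] / 2); first lra.
  have [r0 r1] := andP r_itv.
  move=> /(_ (polar r t) (polar_unit_disc _ _ _)).
  rewrite ImE hr pmulr_rge0//= (ltW r0) r1 mulr_gt0// => /(_ isT isT); lra.
have [|r r_itv hr] := hval 0; first lra.
have [r0 r1] := andP r_itv; have r_itv' : 0 <= r < 1 by rewrite ltW.
have zD := polar_unit_disc r t r_itv'.
have conjE : conjc (polar r t) = polar r (- t).
  by rewrite /polar cosN sinN mulrN.
have wD : unit_disc (conjc (polar r t)).
  by rewrite conjE; apply: polar_unit_disc.
move=> /(_ (polar r t) (conjc (polar r t)) (mem_set zD) (mem_set wD)).
have := ImE r; rewrite hr mulr0 ceval_conj => Im0.
have -> : conjc (ceval f (polar r t)) = ceval f (polar r t).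
  by case: (ceval f _) Im0 => a b /= ->; rewrite oppr0.
(* Injectivity would give $r\sin t=-r\sin t$. *)
move=> /(_ erefl) [] /eqP; have := mulr_gt0 r0 st; lra.
Qed.

Lemma coef_suffridge (R : realType) (N : nat) (mu : R) (k : nat) :
  (suffridge N mu)`_k =
  if (0 < k < N.+1)%N
  then (N.+1 - k)%:R / N%:R * (sin (k%:R * mu) / sin mu) else 0.
Proof.
rewrite coef_sum; case: ifPn => [k_itv|k_nitv].
  rewrite (bigD1_seq k) ?mem_index_iota ?iota_uniq//= coefZ coefXn eqxx mulr1.
  by rewrite big1 ?addr0// => j /negPf jk; rewrite coefZ coefXn eq_sym jk mulr0.
rewrite big_nat big1// => j j_itv; rewrite coefZ coefXn.
by case: eqP j_itv k_nitv => [->|_ _ _]; [move=> -> | rewrite mulr0].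
Qed.

Lemma Im_suffridge_polar1 (R : realType) (N : nat) (mu t : R) :
  complex.Im (ceval (suffridge N mu) (polar 1 t)) =
  (\sum_(1 <= k < N.+1)
     (N.+1 - k)%:R * (sin (k%:R * mu) * sin (k%:R * t))) / (N%:R * sin mu).
Proof.
have szN : (size (suffridge N mu) <= N.+1)%N.
  by apply/leq_sizeP => k Nk; rewrite coef_suffridge (ltnNge k) Nk andbF.
rewrite (Im_ceval_polar _ _ _ szN) -(big_mkord xpredT (fun k =>
  (suffridge N mu)`_k * (1 ^+ k * sin (k%:R * t)))).
rewrite big_ltn// coef_suffridge mul0r add0r mulr_suml.
apply: eq_big_nat => k k_itv.
by rewrite coef_suffridge k_itv expr1n mul1r invfM; ring.
Qed.

(* hN1 and hN2 remove exactly the parameters for which the conclusion fails: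
   the polynomial is z for N = 1, and z + cos mu z^2 for N = 2, which is
   univalent when |cos mu| < 1/2. *)
Theorem mainTheorem2 (R : realType) (N : nat) (mu : R)
  (hN : (1 <= N)%N)
  (hmu : 0 < mu < pi)
  (hexcl : forall j : nat, (1 <= j <= N)%N -> mu <> j%:R * pi / N.+1%:R)
  (hN1 : N <> 1%N)
  (hN2 : N = 2%N -> ~ (pi / 3 < mu < 2 * pi / 3)) :
  ~ typically_real (suffridge N mu) /\ ~ univalent (ceval (suffridge N mu)).
Proof.
have N_gt1 : (1 < N)%N by case: N hN hN1 {hexcl hN2} => [|[]].
have pi0 := pi_gt0 R; have smu := sin_gt0_pi hmu.
have N0 : 0 < N%:R :> R by rewrite ltr0n.
have NS0 : 0 < N.+1%:R :> R by rewrite ltr0n.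
have [s sE t_itv] := suffridge_angle _ _ _ hmu hexcl N_gt1 hN2.
apply: (@Im_lt0_not_typically_real_univalent R _ (mu + s)) => //.
  by rewrite coef_suffridge subn1 mul1r /= ltnS hN !divff ?mulr1 ?gt_eqF.
have d_lt : 2 * pi / N.+1%:R < pi *+ 2 :> R.
  by rewrite ltr_pdivrMr// -(mulr_natl pi) ltr_pMr ?mulr_gt0// ltr1n ltnS.
have d_gt : 0 < 2 * pi / N.+1%:R :> R by rewrite divr_gt0 ?mulr_gt0.
have cs : cos s < 1.
  by case: sE => ->; rewrite ?cosN; apply: cos_lt1; rewrite d_gt d_lt.
have Ns : N.+1%:R * s = pi *+ 2 \/ N.+1%:R * s = - (pi *+ 2).
  by case: sE => ->; [left|right];
    rewrite ?mulrN -(mulr_natl pi) mulrC divfK// gt_eqF.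
have cNs : cos (N.+1%:R * s) = 1 by case: Ns => ->; rewrite ?cosN cos2pi.
have sNs : sin (N.+1%:R * s) = 0.
  by case: Ns => ->; rewrite ?sinN sin2pi ?oppr0.
rewrite Im_suffridge_polar1 pmulr_llt0 ?invr_gt0 ?mulr_gt0//.
(* Both $\mu$ and $\mu+s$ lie in $(0,\pi)$, so their sum lies in $(0,2\pi)$. *)
apply: fejer_sin_sum_lt0 => //; first by apply: cos_lt1; lra.
(* As $(N+1)s=\pm 2\pi$, the cosine is that of $2(N+1)\mu$. It equals 1 only if $(N+1)\mu=j\pi$, and
   $0<\mu<\pi$ then forces $1\le j\le N$, an excluded value. *)
rewrite addrA mulrDr cosD cNs sNs mulr1 mulr0 subr0 mulrDr.
apply/cos_double_lt1/sin_neq0_nat_pi => [|j jE].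
  by rewrite mulr_ge0; lra.
have muE : mu = j%:R * pi / N.+1%:R by rewrite -jE mulrAC divff ?mul1r// gt_eqF.
apply: (hexcl j) => //; apply/andP; split.
  by rewrite lt0n; apply/eqP => j0; move: muE; rewrite j0 !mul0r; lra.
rewrite -ltnS -(ltr_nat R) -(ltr_pM2r pi0) -jE ltr_pM2l//; lra.
Qed.
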